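(* Consider the Norros-Reittu random graph process $(G_k)_{k\ge 0}$ with capacity sequence $\Lambda=(\Lambda_0,\Lambda_1,\dots)$ of i.i.d. random variables satisfying $P\{\Lambda_0\ge 1\}=1$ and $P\{\Lambda_1>x\}=x^{-\tau+1}\ell(x)$ with $\tau>1$ and $\ell$ slowly varying, started from a single node $0$ which holds the message, so that $S_0=\{0\}$, $\#S_0=1$. Let $S_k$ be the set of nodes holding the message after evolution step $k$, and let $L_{k}=\sum_{i=0}^{k}\Lambda_i$. Then for every $k=0,1,2,\dots$ the success probability at step $k+1$, conditionally on $\Lambda$ and $S_k$, is $$p_{k+1}=\mathbb{E}\{\#S_{k+1}-\#S_k\mid S_k,\Lambda\}=1-\prod_{w\in S_k}e^{-\frac{\Lambda_w\Lambda_{k+1}}{L_{k+1}}}.$$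
   Context: Norros-Reittu model with message spreading. The capacities $\Lambda=(\Lambda_0,\Lambda_1,\dots)$ are i.i.d. strictly positive random variables generated beforehand. The graph $G_k$ has node set $V_k=\{0,1,\dots,k\}$. $L_k=\sum_{i=0}^k\Lambda_i$. At evolution step $k+1$ ($k\ge 0$) the new node $k+1$ is added. Given $\Lambda$, for each $i\in\{0,\dots,k+1\}$ the number $E_{k+1}(i,k+1)$ of new edges between $i$ and $k+1$ is a Poisson random variable with mean $\Lambda_i\Lambda_{k+1}/L_{k+1}$. Given $\Lambda$, these variables are independent over $i$, and they are independent of the existing graph structure and of all previous steps (so also of $S_0,\dots,S_k$). In addition each old edge of $G_k$ is independently deleted with probability $1-L_k/L_{k+1}$, but this and self-loops do not affect message propagation. Message spreading: $S_k\subseteq V_k$ is the set of nodes holding the message after step $k$. At step $k+1$ only the new node can receive the message, and it does so if and only if there is at least one new edge between it and a node of $S_k$. That is, $S_{k+1}=S_k\cup\{k+1\}$ if $\sum_{w\in S_k}E_{k+1}(w,k+1)\ge 1$ (called success), and $S_{k+1}=S_k$ otherwise. $\#A$ denotes the cardinality of $A$. A function $\ell$ is slowly varying if $\lim_{x\to\infty}\ell(tx)/\ell(x)=1$ for all $t>0$. *)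

(* Defs.v *)
From HB Require Import structures.
From mathcomp Require Import all_boot all_order all_algebra finmap.
From mathcomp Require Import all_classical all_reals all_analysis.
Set Implicit Arguments.
Unset Strict Implicit.
Unset Printing Implicit Defensive.
Import Order.TTheory GRing.Theory Num.Theory.
Import numFieldTopology.Exports numFieldNormedType.Exports.
Local Open Scope classical_set_scope.
Local Open Scope ring_scope.

Section conditioning.
Context d (T : measurableType d) (R : realType) (P : probability T R).

(* Y is a version of E(X | G), where G is a sub-sigma-algebra. *)
Definition is_cond_expectation (G : set (set T)) (X Y : T -> R) : Prop :=
  [/\ P.-integrable setT (EFin \o X),
      P.-integrable setT (EFin \o Y),
      preimage_set_system setT Y measurable `<=` G
    & forall A, G A ->
        (\int[P]_(w in A) (Y w)%:E = \int[P]_(w in A) (X w)%:E)%E].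

Definition is_cond_prob (G : set (set T)) (A : set T) (q : T -> R) : Prop :=
  is_cond_expectation G \1_A q.

(* P(\bigcap_j A_j | G) = \prod_j P(A_j | G) a.s. for every finite subfamily.
   Versions always exist and are a.s. unique, so it does not matter which
   versions q j are taken. *)
Definition cond_independent (I : choiceType) (G : set (set T))
    (F : I -> set (set T)) : Prop :=
  forall (J : {fset I}) (A : I -> set T),
    (forall j, j \in J -> F j (A j)) ->
    exists2 q : I -> T -> R,
      forall j, j \in J -> is_cond_prob G (A j) (q j)
    & is_cond_prob G (\bigcap_(j in [set` J]) A j)
        (fun w => \prod_(j <- J) q j w).

Definition independent_seq (X : nat -> {RV P >-> R}) : Prop :=
  forall (J : {fset nat}) (B : nat -> set R),
    (forall j, j \in J -> measurable (B j)) ->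
    P (\bigcap_(j in [set` J]) (X j @^-1` B j)) =
    (\prod_(j <- J) P (X j @^-1` B j))%E.

Definition identically_distributed (X : nat -> {RV P >-> R}) : Prop :=
  forall i (B : set R), measurable B ->
    distribution P (X i) B = distribution P (X 0%N) B.

End conditioning.

Definition slowly_varying (R : realType) (l : R -> R) : Prop :=
  forall t : R, 0 < t -> (l (t * x) / l x) @[x --> +oo] --> (1 : R).

Section model.
Context d (T : measurableType d) (R : realType) (P : probability T R).

(* The label (m, i, r) stands for the r-th (from r = 0) of the edges between
   i and m, i <= m, that are created when node m enters. *)
Definition edge_label : Type := (nat * nat * nat)%type.

(* Lam i     : capacity of node i;
   E m i     : number of new edges between i and m at step m
               (E 0 0 counts possible initial self-loops at node 0);
   del m e   : deletion mark at step m of the edge labelled e; a mark is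
               ignored when e is not an edge of G_(m-1). *)
Variables (Lam : nat -> {RV P >-> R}) (E : nat -> nat -> {RV P >-> nat})
  (del : nat -> edge_label -> {RV P >-> bool}).

Definition Lsum (k : nat) (w : T) : R := \sum_(i < k.+1) Lam i w.

(* Edge set of G_k, a multigraph on {0, ..., k}. *)
Fixpoint has_edge (k : nat) (e : edge_label) (w : T) : bool :=
  let: (m, i, r) := e in
  if m == k then (i <= m)%N && (r < E m i w)%N
  else if k is k'.+1 then ~~ del k e w && has_edge k' e w else false.

Definition success (k : nat) (A : {fset nat}) (w : T) : bool :=
  (1 <= \sum_(v <- A) E k v w)%N.

(* S_k: the nodes holding the message after step k. *)
Fixpoint holders (k : nat) (w : T) : {fset nat} :=
  if k is k'.+1 then
    if success k (holders k' w) w then (k |` holders k' w)%fset else holders k' w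
  else [fset 0%N]%fset.

Definition gen_Lam : set (set T) :=
  \bigcup_i preimage_set_system setT (Lam i) measurable.

Definition sigma_Lam : set (set T) := <<s gen_Lam >>.

(* sigma(S_k, Lam); {fset nat} is countable and carries all subsets. *)
Definition sigma_S_Lam (k : nat) : set (set T) :=
  <<s gen_Lam `|` preimage_set_system setT (holders k) setT >>.

(* sigma(E_m, G_m : m <= k) *)
Definition history (k : nat) : set (set T) :=
  <<s \bigcup_(m in [set m | (m <= k)%N])
        ((\bigcup_(i in [set i | (i <= m)%N])
            preimage_set_system setT (E m i) measurable) `|`
         (\bigcup_e preimage_set_system setT (has_edge m e) setT)) >>.

(* What step k+1 involves: the past, the new edges between k+1 and each
   i <= k+1, and the deletion marks. *)
Definition step_sigma (k : nat) (s : option ('I_k.+2 + edge_label)) :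
    set (set T) :=
  match s with
  | None => history k
  | Some (inl i) => preimage_set_system setT (E k.+1 i) measurable
  | Some (inr e) => preimage_set_system setT (del k.+1 e) measurable
  end.

Record norros_reittu : Prop := NorrosReittu {
  nr_pos : forall i, {ae P, forall w, 0 < Lam i w};
  nr_indep : independent_seq Lam;
  nr_ident : identically_distributed Lam;
  nr_poisson : forall k (i : 'I_k.+2) n,
    is_cond_prob P sigma_Lam (E k.+1 i @^-1` [set n])
      (fun w => poisson_pmf (Lam i w * Lam k.+1 w / Lsum k.+1 w) n);
  nr_delete : forall k e,
    is_cond_prob P sigma_Lam (del k.+1 e @^-1` [set true])
      (fun w => 1 - Lsum k w / Lsum k.+1 w);
  nr_step : forall k, cond_independent P sigma_Lam (@step_sigma k)
}.

End model.

(* Main.v *)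
Require Import Defs.
From HB Require Import structures.
From mathcomp Require Import all_boot all_order all_algebra finmap.
From mathcomp Require Import all_classical all_reals all_analysis.
From mathcomp Require Import measurable_realfun.
Import Order.TTheory GRing.Theory Num.Theory.
Import numFieldTopology.Exports numFieldNormedType.Exports.
Local Open Scope classical_set_scope.
Local Open Scope ring_scope.

Set Implicit Arguments.
Unset Strict Implicit.

(** The success probability is one minus the failure probability, so it is enough
   to show that [fail_prob], evaluated at the holders [S_k], is a version of the
   conditional probability that the new node has no new edge to [S_k].  Every
   event of [sigma(S_k, Lam)] coincides on the fibre [S_k = F] with an event of
   [sigma(Lam)], so this can be checked on one fibre at a time, where the holders
   are a constant set [F].  The event [S_k = F] belongs to the history, hence is
   conditionally independent of the new edges given [Lam]; together with the
   Poisson probabilities at 0 this yields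
     P(B, S_k = F, no edge to F)
       = E[1_B P(S_k = F | Lam) prod_(v in F) exp(- Lam_v Lam_(k+1) / L_(k+1))]
   for [B] in [sigma(Lam)].  Pulling the [sigma(Lam)]-measurable product out of the
   conditional expectation turns the right-hand side into the integral of the
   product over [B] and [S_k = F]. *)

(** * Preliminaries: restricted measures and measurability of inversion *)

(** The part of [B] outside [S] is null for the restricted measure, and on subsets of [S] the two
    measures agree. *)
Lemma ge0_integral_mrestr d (T : measurableType d) (R : realType)
    (mu : {measure set T -> \bar R}) (S B : set T) (mS : measurable S)
    (f : T -> \bar R) :
  measurable B -> measurable_fun B f -> (forall x, (0 <= f x)%E) ->
  (\int[mrestr mu mS]_(x in B) f x = \int[mu]_(x in B `&` S) f x)%E.
Proof.
move=> mB mf f0.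
rewrite (@ge0_negligible_integral _ _ _ _ B (B `\` S))//; last 2 first.
- exact: measurableD.
- by rewrite /= /mrestr setDE -setIA setICl setI0 measure0.
rewrite setDD; apply: eq_measure_integral => A mA AS.
by rewrite /= /mrestr setIidl// => x /AS[].
Qed.

(** Inversion is continuous on the open set of nonzero reals, and what remains is one point. *)
Lemma measurable_fun_inv (R : realType) : measurable_fun [set: R] (@GRing.inv R).
Proof.
have -> : [set: R] = [set x | x != 0] `|` [set 0].
  by apply/seteqP; split => // x _; have [->|] := eqVneq x 0; [right|left].
have open_neq0 : open [set x : R | x != 0] by exact: open_neq.
apply/measurable_funU; [exact: open_measurable|exact: measurable_set1|].
split; last exact: measurable_fun_set1.
apply: subspace_continuous_measurable_fun; first exact: open_measurable.
by apply: continuous_in_subspaceT => x; rewrite inE; exact: inv_continuous.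
Qed.

(** * Conditional expectation given a sub-sigma-algebra *)

Section sub_sigma_algebra.
Context d (T : measurableType d) (R : realType) (P : probability T R).
Variable G : set (set T).
Hypothesis Gm : <<s G >> `<=` measurable.

Let T' : measurableType _ := g_sigma_algebraType G.
Let incl : T -> T' := id.

Let measurable_incl : measurable_fun setT incl.
Proof. by move=> _ B mB; rewrite setTI; exact: Gm. Qed.

HB.instance Definition _ :=
  isMeasurableFun.Build _ _ _ _ incl measurable_incl.

(** This is [P] restricted to [<<s G>>], obtained as the image of [P] under the identity into the
    coarser space, so that general theorems on measures apply to it. *)
Let P' : probability T' R := distribution P incl.

Lemma preimage_sub_measurableP (f : T -> R) :
  preimage_set_system setT f measurable `<=` <<s G >> <->
  measurable_fun setT (f : T' -> R).
Proof.
split=> [h _ B mB|h _ [B mB <-]]; last exact: h.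
by apply: h; exists B.
Qed.

Lemma sub_measurable_fun (f : T -> R) :
  measurable_fun setT (f : T' -> R) -> measurable_fun setT f.
Proof. by move=> h _ B mB; apply: Gm; exact: h. Qed.

Lemma integral_sub (f : T -> \bar R) (B : set T) :
  measurable_fun setT (f : T' -> \bar R) -> <<s G >> B ->
  P.-integrable setT f ->
  (\int[P']_(x in B) f x = \int[P]_(x in B) f x)%E.
Proof.
move=> mf GB intf; rewrite integral_pushforward//.
by apply: (integrableS measurableT) => //; exact: Gm.
Qed.

(** Two versions have equal integrals over every event of [<<s G>>], so they agree [P']-a.e., and a
    [P']-null set is [P]-null. *)
Lemma cond_expectation_ae_unique (X q1 q2 : T -> R) :
  is_cond_expectation P <<s G >> X q1 -> is_cond_expectation P <<s G >> X q2 ->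
  {ae P, forall w, q1 w = q2 w}.
Proof.
move=> [_ i1 /preimage_sub_measurableP m1 E1] [_ i2 /preimage_sub_measurableP m2 E2].
have : ae_eq P' setT (EFin \o q1) (EFin \o q2).
  apply: integral_ae_eq => //.
  - by apply: integrable_pushforward => //; exact/measurable_EFinP.
  - exact/measurable_EFinP.
  - move=> B _ mB; rewrite !integral_sub//; [|exact/measurable_EFinP..].
    by rewrite /= E1// E2.
case=> N [mN N0 subN]; exists N; split => //; first exact: Gm.
by apply: subset_trans subN; apply: subsetC => x /= /(_ I)[].
Qed.

Lemma cond_prob_setC (A : set T) (q : T -> R) : measurable A ->
  is_cond_prob P <<s G >> A q ->
  is_cond_prob P <<s G >> (~` A) (fun w => 1 - q w).
Proof.
move=> mA [iA iq /preimage_sub_measurableP mq qE].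
have i1 : P.-integrable setT (EFin \o cst (1 : R)) by exact: finite_measure_integrable_cst.
have XE : \1_(~` A) = (fun w => 1 - \1_A w) :> (T -> R).
  by apply/funext => w; rewrite indicC indicE; case: (w \in A); rewrite ?subrr ?subr0.
split.
- by rewrite XE; exact: (integrableB measurableT i1 iA).
- exact: (integrableB measurableT i1 iq).
- by apply/preimage_sub_measurableP; apply: measurable_funB.
- move=> B GB; have mB := Gm GB.
  have sub f : P.-integrable setT f -> P.-integrable B f.
    by apply: integrableS.
  have -> := integralB mB (sub _ i1) (sub _ iq).
  by rewrite XE qE// -(integralB mB (sub _ i1) (sub _ iA)).
Qed.

Section restriction.
Variables (S : set T) (mS : measurable S).

(** Taken on the coarser space, so that its Radon-Nikodym derivative with respect to [P'] is
    [<<s G>>]-measurable. *)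
Definition sub_mrestr : set T' -> \bar R := fun B => mrestr P mS B.

Let nu0 : sub_mrestr set0 = 0%E. Proof. exact: measure0. Qed.
Let nu_ge0 B : (0 <= sub_mrestr B)%E. Proof. exact: measure_ge0. Qed.
Let nu_additive : semi_sigma_additive sub_mrestr.
Proof.
move=> F mF tF mUF.
apply: (@measure_semi_sigma_additive _ _ _ (mrestr P mS)) => //.
- by move=> i; apply: Gm; exact: mF.
- exact: Gm.
Qed.

HB.instance Definition _ := isMeasure.Build _ _ _ sub_mrestr
  nu0 nu_ge0 nu_additive.

Let nu_fin : fin_num_fun sub_mrestr.
Proof. by move=> B mB; apply: fin_num_measure; exact: Gm. Qed.

HB.instance Definition _ := @Measure_isFinite.Build _ _ _ sub_mrestr nu_fin.

Let nu : {finite_measure set T' -> \bar R} := sub_mrestr.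

Let nu_dom : nu `<< P'.
Proof.
apply/null_content_dominatesP => B mB PB0; apply/eqP.
rewrite eq_le measure_ge0 andbT -PB0; apply: le_measure; rewrite ?inE.
- by apply: measurableI => //; exact: Gm.
- exact: Gm.
- by move=> x [].
Qed.

Lemma integral_sub_mrestr (f : T -> \bar R) (B : set T) :
  measurable_fun setT (f : T' -> \bar R) -> (forall x, 0 <= f x)%E ->
  <<s G >> B ->
  (\int[nu]_(x in B) f x = \int[P]_(x in B `&` S) f x)%E.
Proof.
move=> mf f0 GB.
rewrite -(ge0_integral_mrestr P mS) //; last 2 first.
- exact: Gm.
- by apply: measurable_funTS => _ C mC; apply: Gm; exact: mf.
rewrite -(ge0_integral_pushforward measurable_incl (mrestr P mS))//.
exact: measurable_funTS.
Qed.

(* On [<<s G>>], [q] is a Radon-Nikodym derivative of [B |-> P (B `&` S)]. *)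
Lemma cond_prob_pull_out (q : T -> R) :
  is_cond_prob P <<s G >> S q ->
  forall (Z : T -> R) B, measurable_fun setT (Z : T' -> R) ->
  (forall x, 0 <= Z x) -> <<s G >> B ->
  (\int[P]_(x in B `&` S) (Z x)%:E = \int[P]_(x in B) (Z x * q x)%:E)%E.
Proof.
move=> [_ iq /preimage_sub_measurableP mq qE] Z B mZ Z0 GB.
pose g := Radon_Nikodym_SigmaFinite.f nu P'.
have mg : measurable_fun setT g.
  exact: measurable_int (Radon_Nikodym_SigmaFinite.f_integrable nu_dom).
(* Over any [C] in [<<s G>>] both functions integrate to [P (C]&[S)]. *)
have qg : ae_eq P' setT g (EFin \o q).
  apply: integral_ae_eq => //.
  - exact: (Radon_Nikodym_SigmaFinite.f_integrable nu_dom).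
  - exact/measurable_EFinP.
  - move=> C _ mC; rewrite -Radon_Nikodym_SigmaFinite.f_integral//.
    rewrite integral_sub//; last exact/measurable_EFinP.
    by rewrite qE// integral_indic//; [rewrite setIC|exact: Gm].
rewrite -(integral_sub_mrestr (f := EFin \o Z))//; last exact/measurable_EFinP.
rewrite -(Radon_Nikodym_SigmaFinite.change_of_variables nu_dom)//; last first.
  exact/measurable_funTS/measurable_EFinP.
have mZg : measurable_fun setT (fun x : T' => (Z x)%:E * g x)%E.
  by apply: emeasurable_funM => //; exact/measurable_EFinP.
rewrite ge0_integral_pushforward//; last 2 first.
- exact: measurable_funTS.
- by move=> x _; rewrite mule_ge0 ?lee_fin//; exact: Radon_Nikodym_SigmaFinite.f_ge0.
apply: ae_eq_integral.
- exact: Gm.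
- by apply: measurable_funTS => _ C mC; apply: Gm; exact: mZg.
- by apply/measurable_EFinP/measurable_funTS/measurable_funM; exact: sub_measurable_fun.
- case: qg => N [mN N0 subN]; exists N; split => //; first exact: Gm.
  apply: subset_trans subN; apply: subsetC => x /= /(_ I) gq _.
  by rewrite EFinM -[(q x)%:E]gq.
Qed.

End restriction.

End sub_sigma_algebra.

(** * Decomposition along the fibres of a map *)

Lemma ge0_eq_integral_fibers d (T : measurableType d) (R : realType)
    (mu : {measure set T -> \bar R}) (U : countType) (f : T -> U)
    (g h : T -> \bar R) (A : set T) :
  (forall x, measurable (f @^-1` [set x])) -> measurable A ->
  measurable_fun setT g -> measurable_fun setT h ->
  (forall w, 0 <= g w)%E -> (forall w, 0 <= h w)%E ->
  (forall x, \int[mu]_(w in A `&` f @^-1` [set x]) g w =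
             \int[mu]_(w in A `&` f @^-1` [set x]) h w)%E ->
  (\int[mu]_(w in A) g w = \int[mu]_(w in A) h w)%E.
Proof.
move=> mf mA mg mh g0 h0 gh.
(* The fibres are enumerated by the codes of their values; a number that codes no value gives the
   empty set. *)
pose D n := A `&` [set w | choice.pickle (f w) = n].
have DE n : D n = if choice.unpickle n is Some x then
    if choice.pickle x == n then A `&` f @^-1` [set x] else set0 else set0.
  rewrite /D; apply/seteqP; split => [w [Aw /= <-]|w].
    by rewrite choice.pickleK eqxx.
  case: choice.unpickle => // x; case: eqP => // <- [Aw /= ->]; split => //.
have AE : A = \bigcup_n D n.
  apply/seteqP; split => [w Aw|w [n _ []]//].
  by exists (choice.pickle (f w)).
have mD n : measurable (D n).
  by rewrite DE; case: choice.unpickle => // x; case: ifP => // _; exact: measurableI.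
have tD : trivIset setT D.
  apply/trivIsetP => i j _ _ /eqP ij; apply/seteqP; split => // w [[_ /= wi] [_ /= wj]].
  by apply: ij; rewrite -wi.
rewrite AE !ge0_integral_bigcup//; [|exact: measurable_funTS..].
apply: eq_eseriesr => n _; rewrite DE.
by case: choice.unpickle => [x|]; [case: ifP => _|]; rewrite ?integral_set0.
Qed.

(** The sets with this property form a sigma-algebra, so only generators matter: those from [G]
    serve as their own [B], and a preimage under [f] contains the whole fibre or misses it. *)
Lemma sigma_algebra_atom (T U : Type) (G : set (set T)) (f : T -> U)
    (A : set T) (x : U) :
  <<s G `|` preimage_set_system setT f setT >> A ->
  exists2 B, <<s G >> B &
    A `&` f @^-1` [set x] = B `&` f @^-1` [set x].
Proof.
have [G0 GC GU] := smallest_sigma_algebra setT G.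
apply: (@smallest_sub _ (sigma_algebra setT) _ [set A | exists2 B, <<s G >> B &
    A `&` f @^-1` [set x] = B `&` f @^-1` [set x]]).
- split => [|C [B GB CB]|F FB].
  + by exists set0.
  + exists (setT `\` B); first exact: GC.
    apply/seteqP; split => w [[_ nC] fw]; split => //; split => // Bw; apply: nC.
      by have [] : (C `&` f @^-1` [set x]) w by rewrite CB.
    by have [] : (B `&` f @^-1` [set x]) w by rewrite -CB.
  + have /choice[B GB] : forall n, exists B, <<s G >> B /\
      F n `&` f @^-1` [set x] = B `&` f @^-1` [set x].
      by move=> n; have [B ? ?] := FB n; exists B.
    exists (\bigcup_n B n); first by apply: GU => n; exact: (GB n).1.
    by rewrite !setI_bigcupl; apply: eq_bigcupr => n _; exact: (GB n).2.
- move=> C [GC'|[V _ <-]].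
  + by exists C => //; exact: sub_gen_smallest.
  + have [Vx|nVx] := pselect (V x).
      exists (setT `\` set0); first exact: GC.
      by apply/seteqP; split => w [_ /= fw]; split => //; split => //=; rewrite fw.
    exists set0 => //; apply/seteqP; split => w [] // [_ Vw] fw.
    by case: nVx; rewrite -fw.
Qed.

(** * Measurability of the set of holders *)

Section model.
Context d (T : measurableType d) (R : realType) (P : probability T R).
Variables (Lam : nat -> {RV P >-> R}) (E : nat -> nat -> {RV P >-> nat})
  (del : nat -> edge_label -> {RV P >-> bool}).

Lemma holders_leq k w v : v \in holders E k w -> (v <= k)%N.
Proof.
elim: k => [|k IH] /=; first by rewrite inE => /eqP ->.
case: ifP => _; last by move=> /IH/leqW.
by rewrite !inE => /orP[/eqP ->//|/IH/leqW].
Qed.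

(** This puts failure in the form of a finite intersection, to which conditional independence
    applies. *)
Lemma failure_setE k (A : {fset nat}) :
  ~` [set w | success E k A w] = \bigcap_(v in [set` A]) (E k v @^-1` [set 0%N]).
Proof.
apply/seteqP; split => w /=.
  move/negP; rewrite /success -eqn0Ngt sum_nat_seq_eq0 => /allP A0 v vA.
  exact/eqP/A0.
move=> A0; apply/negP; rewrite /success -eqn0Ngt sum_nat_seq_eq0.
by apply/allP => v vA; apply/implyP => _; apply/eqP/A0.
Qed.

Lemma sigma_success (G : set (set T)) k (A : {fset nat}) :
  (forall v, v \in A -> <<s G >> (E k v @^-1` [set 0%N])) ->
  <<s G >> [set w | success E k A w].
Proof.
move=> GE; rewrite -(setCK [set _ | _]) failure_setE.
apply: (@measurableC _ (g_sigma_algebraType G)).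
by apply: (@bigcap_measurableType _ (g_sigma_algebraType G)) => v /GE.
Qed.

(** By induction on [k]: split according to the previous holders, of which there are countably many
    values; for a fixed value, success depends on finitely many edge counts. Keeping [G] general
    covers both the ambient sigma-algebra and the history. *)
Lemma sigma_holders (G : set (set T)) k :
  (forall m i, (i <= m <= k)%N -> <<s G >> (E m i @^-1` [set 0%N])) ->
  forall A, <<s G >> (holders E k @^-1` [set A]).
Proof.
pose T' := g_sigma_algebraType G.
elim: k => [|k IH] GE A.
  have [<-|A0] := eqVneq [fset 0%N]%fset A.
    rewrite (_ : _ @^-1` _ = setT); last by apply/seteqP; split.
    exact: (@measurableT _ T').
  rewrite (_ : _ @^-1` _ = set0); last first.
    by apply/seteqP; split => // w /= /eqP; rewrite (negPf A0).
  exact: (@measurable0 _ T').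
rewrite (_ : _ @^-1` _ = \bigcup_(B : {fset nat}) (holders E k @^-1` [set B] `&`
    [set w | (if success E k.+1 B w then k.+1 |` B else B)%fset = A])); last first.
  apply/seteqP; split => [w /= <-|w [B _ [/= -> //]]].
  by exists (holders E k w).
apply: (@countable_bigcupT_measurable _ T'); first exact: countableP.
move=> B.
(* A point of the fibre is needed to bound the elements of [B] by [k]; an empty fibre is trivial. *)
have [[w0 w0B]|noB] := pselect (exists w, holders E k w = B); last first.
  rewrite (_ : _ `&` _ = set0); first exact: (@measurable0 _ T').
  by apply/seteqP; split => // w [/= wB _]; apply: noB; exists w.
apply: (@measurableI _ T').
  by apply: IH => m i /andP[im mk]; apply: GE; rewrite im leqW.
have GS : <<s G >> [set w | success E k.+1 B w].
  apply: sigma_success => v; rewrite -w0B => /holders_leq vk.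
  by apply: GE; rewrite leqnn leqW.
rewrite (_ : [set w | _] =
  ([set w | success E k.+1 B w] `&` [set w | (k.+1 |` B)%fset = A]) `|`
  (~` [set w | success E k.+1 B w] `&` [set w | B = A])); last first.
  apply/seteqP; split => w /=; first by case: ifP => _ ->; [left|right].
  by case: ifP => wS [] [].
have Gcst (p : Prop) : <<s G >> [set _ | p].
  have [pT|pF] := pselect p.
    by rewrite (_ : mkset _ = setT);
      [exact: (@measurableT _ T')|apply/seteqP; split].
  by rewrite (_ : mkset _ = set0);
    [exact: (@measurable0 _ T')|apply/seteqP; split].
apply: (@measurableU _ T' _ _); apply: (@measurableI _ T' _ _) => //.
- exact: Gcst.
- exact: (@measurableC _ T').
- exact: Gcst.
Qed.

Lemma sigma_Lam_measurable : sigma_Lam Lam `<=` measurable.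
Proof.
apply: smallest_sub; first exact: sigma_algebra_measurable.
by move=> _ [i _ [B mB <-]]; rewrite setTI; exact: measurable_funPTI.
Qed.

Lemma holders_measurable k A : measurable (holders E k @^-1` [set A]).
Proof.
rewrite -[measurable]measurable_g_measurableTypeE; last exact: sigma_algebra_measurable.
apply: sigma_holders => m i _; apply: sub_gen_smallest.
exact: measurable_funPTI.
Qed.

Lemma sigma_S_Lam_measurable k : sigma_S_Lam Lam E k `<=` measurable.
Proof.
apply: smallest_sub; first exact: sigma_algebra_measurable.
move=> A [GA|[V _ <-]].
  by apply: sigma_Lam_measurable; exact: sub_gen_smallest.
rewrite setTI (_ : _ @^-1` _ = \bigcup_(x in V) holders E k @^-1` [set x]); last first.
  by apply/seteqP; split => [w Vw|w [x Vx /= ->]]; [exists (holders E k w)|].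
rewrite bigcup_mkcond; apply: countable_bigcupT_measurable; first exact: countableP.
by move=> x; case: ifP => _ //; exact: holders_measurable.
Qed.

(** This allows [S_k = F] to be the event with label [None] in the conditional independence of step
    [k.+1]. *)
Lemma history_holders k A : history E del k (holders E k @^-1` [set A]).
Proof.
apply: sigma_holders => m i /andP[im mk]; apply: sub_gen_smallest.
exists m => //; left; exists i => //.
by exists [set 0%N]; rewrite ?setTI.
Qed.

End model.

(** * The failure probability for a fixed set of holders *)

Section failure.
Context d (T : measurableType d) (R : realType) (P : probability T R).
Variables (Lam : nat -> {RV P >-> R}) (E : nat -> nat -> {RV P >-> nat})
  (del : nat -> edge_label -> {RV P >-> bool}).

(** The set [A] is a parameter and not the random set of holders, which keeps the function
    measurable with respect to [sigma_Lam]. *)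
Definition fail_prob k (A : {fset nat}) (w : T) : R :=
  \prod_(v <- A) expR (- (Lam v w * Lam k.+1 w / Lsum Lam k.+1 w)).

Lemma fail_prob_ge0 k A w : 0 <= fail_prob k A w.
Proof. by apply: prodr_ge0 => v _; exact: expR_ge0. Qed.

Lemma fail_prob_measurable (G : set (set T)) k A : gen_Lam Lam `<=` G ->
  measurable_fun setT (fail_prob k A : g_sigma_algebraType G -> R).
Proof.
move=> LG; have mLam i : measurable_fun setT (Lam i : g_sigma_algebraType G -> R).
  move=> _ B mB; apply: sub_gen_smallest; apply: LG.
  by exists i => //; exists B.
apply: measurable_prod => v _; apply: measurableT_comp => //.
apply: measurableT_comp => //; apply: measurable_funM; first exact: measurable_funM.
apply: measurableT_comp; first exact: measurable_fun_inv.
exact: measurable_sum.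
Qed.

Hypothesis model : norros_reittu Lam E del.

(** [poisson_pmf] follows the Poisson formula for positive rates only, hence the appeal to a.s.
    positivity of all capacities simultaneously. *)
Lemma poisson_pmf0_ae k :
  {ae P, forall w, forall v, (v <= k)%N ->
    poisson_pmf (Lam v w * Lam k.+1 w / Lsum Lam k.+1 w) 0 =
    expR (- (Lam v w * Lam k.+1 w / Lsum Lam k.+1 w))}.
Proof.
have := ae_foralln (nr_pos model); apply: filterS => w Lam0 v _.
rewrite /poisson_pmf expr0 fact0 invr1 !mul1r ifT//.
rewrite divr_gt0 ?mulr_gt0// /Lsum big_ord_recl ltr_pwDl// sumr_ge0// => i _.
exact: ltW.
Qed.

Lemma integral_fail_prob k (F : {fset nat}) (B : set T) :
  (forall v, v \in F -> (v <= k)%N) -> sigma_Lam Lam B ->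
  (\int[P]_(w in B `&` holders E k @^-1` [set F]) (fail_prob k F w)%:E =
   P (B `&` holders E k @^-1` [set F] `&` ~` [set w | success E k.+1 F w]))%E.
Proof.
move=> Fk GB; set S := holders E k @^-1` [set F].
(* [inord] keeps the value of each [v] in [F], since [v] is at most [k]. *)
pose f v : option ('I_k.+2 + edge_label) := Some (inl (inord v)).
have inordF v : v \in F -> (inord v : 'I_k.+2) = v :> nat.
  by move=> /Fk vk; rewrite inordK// !ltnS leqW.
(* The subfamily consists of the history and the new edges to [F]. Deletion labels lie outside [J]
   and get the default event [setT]. *)
pose J := (None |` [fset f v | v in F])%fset.
pose A (s : option ('I_k.+2 + edge_label)) := match s with
  | None => S
  | Some (inl i) => E k.+1 i @^-1` [set 0%N]
  | Some (inr e) => setT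
  end.
have AJ : \bigcap_(j in [set` J]) A j = S `&` ~` [set w | success E k.+1 F w].
  rewrite failure_setE; apply/seteqP; split => w.
    move=> Aw; split; first by apply: (Aw None); rewrite /= !inE.
    move=> v /= vF; have := Aw (f v); rewrite /= inordF//; apply.
    by rewrite !inE; apply/imfsetP; exists v.
  move=> [Sw Nw] s /=; rewrite !inE => /orP[/eqP ->//|/imfsetP[v /= vF ->]].
  by rewrite /= inordF//; exact: Nw.
have [s|q qE qJ] := nr_step model (J := J) (A := A) (k := k).
  rewrite !inE => /orP[/eqP ->|/imfsetP[v /= vF ->]] /=.
    exact: history_holders.
  by exists [set 0%N]; rewrite ?setTI.
have qN : is_cond_prob P (sigma_Lam Lam) S (q None) by apply: (qE None); rewrite !inE.
(* Conditional independence supplies some versions [q]; a.e. uniqueness identifies them with the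
   Poisson ones. *)
have qf : {ae P, forall w, forall v, v \in F ->
    q (f v) w = expR (- (Lam v w * Lam k.+1 w / Lsum Lam k.+1 w))}.
  have : {ae P, forall w, forall v, v \in F -> q (f v) w =
      poisson_pmf (Lam v w * Lam k.+1 w / Lsum Lam k.+1 w) 0}.
    apply: ae_foralln => v; have [vF|vF] := boolP (v \in F); last exact: aeW.
    have fJ : f v \in J by rewrite !inE; apply/imfsetP; exists v.
    have := nr_poisson model (inord v : 'I_k.+2) 0; rewrite inordF// => qv.
    have := qE _ fJ; rewrite /= inordF// => qv'.
    have := cond_expectation_ae_unique (sigma_Lam_measurable (Lam := Lam)) qv' qv.
    by apply: filterS => w ->.
  apply: filterS2 (poisson_pmf0_ae k) => w pw qw v vF.
  by rewrite qw// pw// Fk.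
rewrite (cond_prob_pull_out (sigma_Lam_measurable (Lam := Lam)) _ qN)//; last 3 first.
- exact: holders_measurable.
- exact: fail_prob_measurable.
- exact: fail_prob_ge0.
have mB := sigma_Lam_measurable GB.
have mA : measurable (\bigcap_(j in [set` J]) A j).
  rewrite AJ; apply: measurableI; first exact: holders_measurable.
  rewrite failure_setE; apply: bigcap_measurableType => v _.
  exact: measurable_funPTI.
have [_ iqJ _ /(_ _ GB)] := qJ.
(* The probability is now the integral over [B] of the product of all [q j], so the two integrands
   can be compared a.e. *)
rewrite (integral_indic _ mB mA) AJ setIC setIA => <-.
have [_ iqN _ _] := qN.
apply: ae_eq_integral => //.
- apply/measurable_EFinP/measurable_funTS/measurable_funM.
    apply: sub_measurable_fun (fail_prob_measurable _ _ (@subset_refl _ _)).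
    exact: sigma_Lam_measurable.
  by move/measurable_int : iqN => /measurable_EFinP.
- by apply: measurable_funTS; exact: measurable_int iqJ.
- apply: filterS qf => w qw _; congr EFin.
  (* [None] differs from every [f v] and [f] is injective on [F], so the product splits into
     [q None] and a product over [F]. *)
  rewrite big_fsetU1 /=; last by apply/imfsetP => -[].
  rewrite mulrC; congr (_ * _).
  rewrite big_imfset /=; last first.
    by move=> u v uF vF [] /(congr1 val) /=; rewrite !inordF.
  by rewrite /fail_prob big_seq [RHS]big_seq; apply: eq_bigr => v vF; rewrite qw.
Qed.

End failure.

(** * Conditioning on the capacities and the random set of holders *)

Section success_probability.
Context d (T : measurableType d) (R : realType) (P : probability T R).
Variables (Lam : nat -> {RV P >-> R}) (E : nat -> nat -> {RV P >-> nat})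
  (del : nat -> edge_label -> {RV P >-> bool}).
Hypothesis model : norros_reittu Lam E del.
Variable k : nat.

Let S := sigma_S_Lam Lam E k.
Let S_holders A : S (holders E k @^-1` [set A]).
Proof.
by apply: sub_gen_smallest; right; exists [set A]; rewrite ?setTI.
Qed.

(** On each of the countably many fibres of [holders E k] the index set is constant. *)
Lemma fail_prob_holders_measurable :
  preimage_set_system setT (fun w => fail_prob Lam k (holders E k w) w) measurable `<=` S.
Proof.
move=> _ [B mB <-]; rewrite setTI.
pose G := gen_Lam Lam `|` preimage_set_system setT (holders E k) setT.
rewrite (_ : _ @^-1` _ = \bigcup_A (holders E k @^-1` [set A] `&`
    fail_prob Lam k A @^-1` B)); last first.
  apply/seteqP; split => [w Bw|w [A _ [/= ->]]//].
  by exists (holders E k w).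
apply: (@countable_bigcupT_measurable _ (g_sigma_algebraType G)) => [|A].
  exact: countableP.
apply: (@measurableI _ (g_sigma_algebraType G)); first exact: S_holders.
rewrite -[X in measurable X]setTI.
by apply: fail_prob_measurable => //; exact: subsetUl.
Qed.

Lemma success_measurable :
  measurable [set w | success E k.+1 (holders E k w) w].
Proof.
rewrite (_ : [set w | _] = \bigcup_A (holders E k @^-1` [set A] `&`
    [set w | success E k.+1 A w])); last first.
  apply/seteqP; split => [w /= Bw|w [A _ [/= ->]]//].
  by exists (holders E k w).
apply: countable_bigcupT_measurable; first exact: countableP.
move=> A; apply: measurableI; first exact: holders_measurable.
rewrite -(setCK [set _ | _]) failure_setE; apply: measurableC.
by apply: bigcap_measurableType => v _; exact: measurable_funPTI.
Qed.

Lemma cond_prob_failure :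
  is_cond_prob P S (~` [set w | success E k.+1 (holders E k w) w])
    (fun w => fail_prob Lam k (holders E k w) w).
Proof.
set N := ~` _; pose Z w := fail_prob Lam k (holders E k w) w.
have mN : measurable N by apply: measurableC; exact: success_measurable.
have Sm : S `<=` measurable by exact: sigma_S_Lam_measurable.
have mZ : measurable_fun setT Z.
  move=> _ B mB; apply: Sm; apply: fail_prob_holders_measurable.
  by exists B.
have Z0 w : 0 <= Z w by exact: fail_prob_ge0.
have ZN A : S A -> (\int[P]_(w in A) (Z w)%:E = \int[P]_(w in A) (\1_N w)%:E)%E.
  move=> SA; apply: (ge0_eq_integral_fibers (f := holders E k)).
  - exact: holders_measurable.
  - exact: Sm.
  - exact/measurable_EFinP.
  - by apply/measurable_EFinP; exact: measurable_indic.
  - by move=> w; rewrite lee_fin.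
  - by move=> w; rewrite lee_fin.
  (* On the fibre of [F], the event [A] is replaced by an event [B] of [sigma_Lam], as
     [integral_fail_prob] requires. *)
  move=> F; have [B GB ->] := sigma_algebra_atom F SA.
  have [[w0 w0F]|noF] := pselect (exists w, holders E k w = F); last first.
    rewrite (_ : _ `&` _ = set0) ?integral_set0//.
    by apply/seteqP; split => // w [_ /= wF]; apply: noF; exists w.
  have mBF : measurable (B `&` holders E k @^-1` [set F]).
    apply: measurableI; last exact: holders_measurable.
    exact: sigma_Lam_measurable GB.
  rewrite integral_indic//.
  transitivity (\int[P]_(w in B `&` holders E k @^-1` [set F]) (fail_prob Lam k F w)%:E)%E.
    by apply: eq_integral => w; rewrite inE => -[_ /= wF]; rewrite /Z wF.
  rewrite (integral_fail_prob model)//; last first.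
    by move=> v; rewrite -w0F => /holders_leq.
  congr (P _); apply/seteqP; split => w.
    by move=> [[Bw /= wF] nS]; split => //; rewrite /N /= wF.
  by move=> [Nw [Bw /= wF]]; split => //; move: Nw; rewrite /N /= wF.
split => //.
- apply/integrableP; split; first exact/measurable_EFinP/measurable_indic.
  under eq_integral do rewrite gee0_abs ?lee_fin//.
  by rewrite integral_indic// setIT ltey_eq fin_num_measure.
- apply/integrableP; split; first exact/measurable_EFinP.
  have -> : (\int[P]_w `|(Z w)%:E| = \int[P]_w (Z w)%:E)%E.
    by apply: eq_integral => w _; rewrite /= ger0_norm.
  (* Integrability of [Z] comes from the identity [ZN] on the whole space: the integral equals
     [P N], which is finite. *)
  rewrite ZN; last by rewrite -setC0; apply: sigma_algebraC; exact: sigma_algebra0.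
  by rewrite integral_indic// setIT ltey_eq fin_num_measure.
- exact: fail_prob_holders_measurable.
Qed.

End success_probability.

(** Earlier holders are at most [k], so on success node [k.+1] is new and raises the count by
    exactly one. *)
Lemma card_holdersS d (T : measurableType d) (R : realType) (P : probability T R)
    (E : nat -> nat -> {RV P >-> nat}) k (w : T) :
  (#|` holders E k.+1 w|)%:R - (#|` holders E k w|)%:R =
  \1_[set w | success E k.+1 (holders E k w) w] w :> R.
Proof.
rewrite indicE /=; case: ifPn => wS; last by rewrite subrr memNset//; exact/negP.
rewrite mem_set// cardfsU1 (_ : _ \notin _) ?natrD ?addrK//.
by apply/negP => /holders_leq; rewrite ltnn.
Qed.

Unset Implicit Arguments.
Set Strict Implicit.

Theorem lemma2 (d : measure_display) (T : measurableType d) (R : realType)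
    (P : probability T R)
    (Lam : nat -> {RV P >-> R}) (E : nat -> nat -> {RV P >-> nat})
    (del : nat -> edge_label -> {RV P >-> bool})
    (tau : R) (l : R -> R)
    (model : norros_reittu Lam E del)
    (Lam_ge1 : P [set w | 1 <= Lam 0%N w] = 1%E)
    (tau_gt1 : 1 < tau)
    (l_slow : slowly_varying l)
    (tail : forall x : R, 1 <= x ->
       P [set w | x < Lam 1%N w] = (x `^ (- tau + 1) * l x)%:E)
    (k : nat) :
  let p : T -> R := fun w =>
    1 - \prod_(v <- holders E k w) expR (- (Lam v w * Lam k.+1 w / Lsum Lam k.+1 w)) in
  is_cond_prob P (sigma_S_Lam Lam E k)
    [set w | success E k.+1 (holders E k w) w] p /\
  is_cond_expectation P (sigma_S_Lam Lam E k)
    (fun w => (#|` holders E k.+1 w|)%:R - (#|` holders E k w|)%:R) p.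
Proof.
move=> p.
have Hp : is_cond_prob P (sigma_S_Lam Lam E k)
    [set w | success E k.+1 (holders E k w) w] p.
  rewrite -(setCK [set w | _]); apply: cond_prob_setC.
  - exact: sigma_S_Lam_measurable.
  - by apply: measurableC; exact: success_measurable.
  - exact: cond_prob_failure model k.
split => //.
(* The increment is the indicator of success, so the second claim is the first one again. *)
rewrite (_ : (fun w => _) = \1_[set w | success E k.+1 (holders E k w) w])//.
by apply/funext => w; exact: card_holdersS.
Qed.
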